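(* For all integers $n,m,k\geq 0$, $$A_{n+m,m}=\sum_{j=0}^{n}(-1)^{n-j}\binom{n}{j}B_{m+j},\qquad A_{n+m+k,m+k}=\sum_{j=0}^{m}\binom{m}{j}A_{n+k+j,k}.$$
   Context: A partition of a finite set is a collection of nonempty, pairwise disjoint subsets (blocks) whose union is the set; a singleton of a partition is a block with exactly one element. $B_n$ denotes the $n$-th Bell number, the number of partitions of $\{1,\dots,n\}$ ($B_0=1$). For integers $0\leq k\leq n$, $A_{n,k}$ denotes the number of partitions of $\{1,2,\dots,n+1\}$ whose largest singleton is $k+1$ (i.e. $\{k+1\}$ is a block and no $j>k+1$ forms a singleton block). *)

(* Defs.v *)
From mathcomp Require Import all_boot all_order all_algebra.

Set Implicit Arguments.
Unset Strict Implicit.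
Unset Printing Implicit Defensive.

(* The set {1, ..., n} is represented by 'I_n = {0, ..., n - 1}: the element   *)
(* i : 'I_n stands for the integer i + 1.                                      *)

Definition set_partitions (n : nat) : {set {set {set 'I_n}}} :=
  [set P : {set {set 'I_n}} | partition P [set: 'I_n]].

Definition bell (n : nat) : nat := #|set_partitions n|.

Definition largest_singleton (n : nat) (P : {set {set 'I_n}}) (i : 'I_n) : bool :=
  ([set i] \in P) && [forall j : 'I_n, (i < j) ==> ([set j] \notin P)].

(* The index k stands for the element k + 1 of {1, ..., n + 1}; the value is 0 *)
(* outside the intended range k <= n.                                          *)
Definition num_largest_singleton (n k : nat) : nat :=
  #|[set P in set_partitions n.+1 |
      [exists i : 'I_n.+1, (nat_of_ord i == k) && largest_singleton P i]]|.

(* Main.v *)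
Require Import Defs.
From mathcomp Require Import all_boot all_order all_algebra.

Set Implicit Arguments.
Unset Strict Implicit.
Unset Printing Implicit Defensive.

(**
  Let [F n m] count the partitions of an [(n + m)]-set none of whose singletons
  lies in a fixed [n]-subset.  Deleting the largest singleton shows that
  [A_{n+m,m} = F n m].  Splitting according to whether a given unconstrained
  element is a singleton yields [F n m.+1 = F n.+1 m + F n m], so [F n] is the
  [n]-th forward difference of [F 0], the Bell sequence.  Both identities are
  the two standard binomial expansions for iterated forward differences.
*)

Import GRing.Theory.

Local Open Scope ring_scope.

(** Pascal's rule summed against [a]; it drives the induction of both binomial expansions below. *)
Lemma sum_binS (V : zmodType) (n : nat) (a : nat -> V) :
  \sum_(j < n.+2) a j *+ 'C(n.+1, j) =
  \sum_(j < n.+1) a j *+ 'C(n, j) + \sum_(j < n.+1) a j.+1 *+ 'C(n, j).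
Proof.
rewrite big_ord_recl /= bin0.
under eq_bigr => j _ do rewrite /bump /= add1n binS mulrnDr.
rewrite big_split /= addrA; congr (_ + _).
by rewrite big_ord_recr /= bin_small // mulr0n addr0 [RHS]big_ord_recl bin0.
Qed.

Fixpoint fdiff (V : zmodType) (n : nat) (u : nat -> V) (m : nat) : V :=
  if n is n'.+1 then fdiff n' u m.+1 - fdiff n' u m else u m.

(** With [E] the shift operator, this expands [(E - 1)^n]. *)
Lemma fdiff_sum (R : pzRingType) (n : nat) (u : nat -> R) (m : nat) :
  fdiff n u m = \sum_(j < n.+1) (-1) ^+ (n - j)%N * 'C(n, j)%:R * u (m + j)%N.
Proof.
have mulC k j : (-1) ^+ k * 'C(n, j)%:R * u (m + j)%N =
    (-1) ^+ k * u (m + j)%N *+ 'C(n, j) by rewrite mulr_natr mulrnAl.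
under eq_bigr => j _ do rewrite mulC.
elim: n m {mulC} => [|n IHn] m /=.
  by rewrite big_ord1 addn0 bin0 expr0 mul1r.
(* The shifted sum is the expansion at [m.+1]; the unshifted one carries an extra sign and gives
   minus the expansion at [m]. *)
rewrite (sum_binS n (fun j => (-1) ^+ (n.+1 - j)%N * u (m + j)%N)) [RHS]addrC !IHn.
rewrite -sumrN; congr (_ + _); apply: eq_bigr => j _.
  by rewrite subSS addSnnS.
by rewrite subSn -1?ltnS // exprS mulN1r mulNr mulNrn.
Qed.

(** The converse expansion: the shift by [m] is [(1 + Delta)^m], with [Delta] the forward
    difference. *)
Lemma fdiffD (V : zmodType) (n : nat) (u : nat -> V) (m k : nat) :
  fdiff n u (m + k) = \sum_(j < m.+1) fdiff (n + j) u k *+ 'C(m, j).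
Proof.
elim: m k => [|m IHm] k; first by rewrite big_ord1 addn0 bin0.
rewrite (sum_binS m (fun j => fdiff (n + j) u k)) addSnnS IHm -big_split.
apply: eq_bigr => j _ /=.
by rewrite -mulrnDl addnS /= addrC subrK.
Qed.

(** The ground set [D] is a subset of a fixed type, so that deleting an element does not change the
    type. *)
Definition partitions_avoiding (T : finType) (D N : {set T}) :=
  [set P : {set {set T}} | partition P D & [forall x in N, [set x] \notin P]].

(** Removing the block [[set x]] is a bijection; as [x] is outside [N], putting it back creates no
    forbidden singleton. *)
Lemma card_partitions_singleton (T : finType) (D N : {set T}) (x : T) :
  x \in D -> x \notin N ->
  #|[set P in partitions_avoiding D N | [set x] \in P]| =
  #|partitions_avoiding (D :\ x) N|.
Proof.
move=> Dx Nx.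
have neq1 y : y \in N -> [set y] != [set x].
  by move=> Ny; rewrite (inj_eq set1_inj); apply: contraNneq Nx => <-.
rewrite -(@card_in_imset _ _ (fun P => P :\ [set x])); last first.
  move=> P Q; rewrite !inE => /andP[_ Px] /andP[_ Qx] eqPQ.
  by rewrite -(setD1K Px) eqPQ setD1K.
congr #|pred_of_set _|; apply/setP => Q; apply/imsetP/idP => [[P] | ].
  rewrite !inE => /andP[/andP[partP /forall_inP avP] Px] ->.
  rewrite partitionD1 //=; apply/forall_inP => y Ny.
  by rewrite !inE negb_and avP ?orbT.
rewrite inE => /andP[partQ /forall_inP avQ].
have dis : [disjoint [set x] & D :\ x] by rewrite disjoints1 !inE eqxx.
have Qx : [set x] \notin Q.
  apply: contraTN dis => /(partitionS partQ).
  by rewrite sub1set !inE eqxx.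
exists ([set x] |: Q); last by rewrite setU1K.
rewrite !inE eqxx andbT; apply/andP; split.
  rewrite -(setD1K Dx); apply: partitionU1 => //.
  by rewrite -card_gt0 cards1.
by apply/forall_inP => y Ny; rewrite !inE negb_or neq1 ?avQ.
Qed.

Lemma card_partitions_avoidingU1 (T : finType) (D N : {set T}) (x : T) :
  x \in D -> x \notin N ->
  #|partitions_avoiding D N| =
  (#|partitions_avoiding D (x |: N)| + #|partitions_avoiding (D :\ x) N|)%N.
Proof.
move=> Dx Nx; rewrite -(card_partitions_singleton Dx Nx).
rewrite -(cardsID [set P : {set {set T}} | [set x] \in P]) addnC.
congr (_ + _)%N; congr #|pred_of_set _|; apply/setP => P; rewrite !inE //.
rewrite [LHS]andbC -andbA; congr (_ && _).
apply/andP/forall_inP => [[/forall_inP avP Px] y | avP].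
  by case/setU1P => [-> | /avP].
by split; [apply/forall_inP => y Ny; apply/avP/setU1r | apply/avP/setU11].
Qed.

(** Partitions are transported along the enumeration of [D], blocks being recovered as preimages. *)
Lemma card_partitions (T : finType) (D : {set T}) :
  #|[set P | partition P D]| = bell #|D|.
Proof.
pose f : 'I_#|D| -> T := enum_val.
have inj_f : injective f by apply: enum_val_inj.
have imf : f @: [set: 'I_#|D|] = D.
  apply/setP => x; apply/imsetP/idP => [[i _ ->] | Dx]; first exact: enum_valP.
  by exists (enum_rank_in Dx x); rewrite // /f enum_rankK_in.
pose F (P : {set {set 'I_#|D|}}) := (fun A : {set 'I_#|D|} => f @: A) @: P.
have inj_F : injective F by do 2 apply: imset_inj.
rewrite /bell -(card_imset _ inj_F); congr #|pred_of_set _|.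
apply/setP => Q; rewrite inE; apply/idP/imsetP => [partQ | [P]]; last first.
  by rewrite inE -(imset_partition _ _ inj_f) imf => ? ->.
have preK B : B \in Q -> f @: (f @^-1: B) = B.
  move=> /(partitionS partQ) sBD; apply/setP => x.
  apply/imsetP/idP => [[i] | Bx]; first by rewrite inE => ? ->.
  have := subsetP sBD x Bx; rewrite -{1}imf => /imsetP[i _ def_x].
  by exists i; rewrite // inE -def_x.
have defQ : Q = F [set f @^-1: (B : {set T}) | B in Q].
  rewrite /F -imset_comp -[LHS]imset_id; apply: eq_in_imset => B /preK /=.
  by move->.
exists [set f @^-1: (B : {set T}) | B in Q] => //.
by rewrite inE -(imset_partition _ _ inj_f) imf -/(F _) -defQ.
Qed.

Lemma card_partitions_avoiding (T : finType) (D N : {set T}) (m : nat) :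
  N \subset D -> #|D| = (#|N| + m)%N ->
  #|partitions_avoiding D N|%:Z = fdiff #|N| (fun j => (bell j)%:Z) m.
Proof.
move def_n: #|N| => n; elim: n => [|n IHn] in D N m def_n *.
  move=> _ cardD /=; rewrite add0n in cardD; rewrite -cardD -card_partitions.
  congr Posz; apply: eq_card => P; rewrite !inE (cards0_eq def_n).
  by case: forall_inP => [|[]]; rewrite ?andbT // => x; rewrite inE.
move=> sND cardD.
have /card_gt0P[x Nx] : (0 < #|N|)%N by rewrite def_n.
have Dx := subsetP sND x Nx.
have cardN : #|N :\ x| = n by move: def_n; rewrite (cardsD1 x) Nx => -[].
have cardDx : #|D :\ x| = (n + m)%N.
  by move: cardD; rewrite (cardsD1 x) Dx => -[].
(* The splitting at [x], applied to [N :\ x] and solved for the count that avoids all of [N], is the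
   recursion of [fdiff]. *)
have := card_partitions_avoidingU1 Dx (negbT (setD11 x N)).
rewrite setD1K // => /(congr1 Posz); rewrite PoszD => /eqP.
rewrite -subr_eq => /eqP <-.
rewrite (IHn _ _ m.+1) ?(IHn _ _ m) ?setSD ?cardD ?addSnnS //=.
by apply: subset_trans sND; rewrite subD1set.
Qed.

Lemma num_largest_singletonE (n m : nat) :
  (num_largest_singleton (n + m) m)%:Z = fdiff n (fun j => (bell j)%:Z) m.
Proof.
have ltm : (m < (n + m).+1)%N by rewrite ltnS leq_addl.
pose i : 'I_(n + m).+1 := Ordinal ltm.
pose N := [set j : 'I_(n + m).+1 | (i < j)%N].
have Ni : i \notin N by rewrite inE ltnn.
have cardN : #|N| = n.
  have := cardsC N; rewrite card_ord.
  (* The complement of [N] is [{0, ..., m}], which includes [i] itself; deleting [i] leaves [m]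
     unconstrained elements. *)
  have -> : #|~: N| = m.+1.
    have inj_w : injective (widen_ord ltm) by move=> a b [/val_inj].
    rewrite -[RHS]card_ord -(card_imset _ inj_w).
    apply: eq_card => j; rewrite !inE -leqNgt.
    apply/idP/imsetP => [lejm | [k _ ->]]; last by rewrite /= -ltnS.
    by exists (Ordinal (lejm : (j < m.+1)%N)); [|apply: val_inj].
  by rewrite -[RHS]addnS => /addIn.
rewrite -[in RHS]cardN -(@card_partitions_avoiding _ ([set: _] :\ i) N m).
- rewrite -(card_partitions_singleton (in_setT i) Ni); congr Posz.
  apply: eq_card => P; rewrite !inE -andbA; congr (_ && _).
  apply/existsP/andP => [[j /andP[/eqP eqjm]] | [/forall_inP avP Pi]].
    have -> : j = i by apply: val_inj.
    case/andP=> Pi /forall_inP avP; split=> //.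
    by apply/forall_inP => l; rewrite inE; apply: avP.
  exists i; rewrite eqxx /largest_singleton Pi /=.
  by apply/forall_inP => l ltil; apply: avP; rewrite inE.
- apply/subsetP => j; rewrite !inE andbT => ltij.
  by apply: contraTneq ltij => ->; rewrite ltnn.
- have := cardsD1 i [set: 'I_(n + m).+1].
  by rewrite cardsT card_ord inE cardN => -[].
Qed.

Theorem theorem2p4 (n m k : nat) :
  ((num_largest_singleton (n + m) m)%:Z =
     \sum_(j < n.+1) (-1) ^+ (n - j)%N * ('C(n, j))%:Z * (bell (m + j))%:Z)
  /\
  (num_largest_singleton (n + m + k) (m + k) =
     \sum_(j < m.+1) 'C(m, j) * num_largest_singleton (n + k + j) k)%N.
Proof.
split.
  rewrite num_largest_singletonE fdiff_sum.
  by apply: eq_bigr => j _; rewrite natz.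
(* Regrouped as [n + (m + k)], the left side is an [n]-th difference at [m + k], ready for expansion
   around [k]. *)
apply/eqP; rewrite -eqz_nat -addnA num_largest_singletonE fdiffD.
rewrite -natz natr_sum; apply/eqP/eq_bigr => j _.
by rewrite addnAC -num_largest_singletonE -[LHS]mulr_natl natrM !natz.
Qed.
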